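(* Let $L$ be a frame and $a\in L$. Consider the map $\kappa_a\colon L\to a^{\uparrow}$ defined by $\kappa_a(x):=x\vee a$. The following properties are equivalent: (1) $\kappa_a$ preserves essential elements. (2) $a$ is regular. (3) $\kappa_a$ preserves essential elements and $\mu$-elements.
   Context: A frame is a complete lattice $(L,\leqslant,0,1)$ in which finite meets distribute over arbitrary joins (equivalently, an integral commutative quantale whose multiplication is the meet). $a^{\uparrow}:=\{x\in L\mid a\leqslant x\leqslant 1\}$, a frame with bottom element $a$. In a lattice $M$ with bottom $0_M$, an element $x$ is essential if $x\wedge y\neq 0_M$ for all $y\in M$ with $y\neq 0_M$; and $x$ is a $\mu$-element if for every natural number $n\geqslant 2$ and all $y_1,\ldots,y_n\in M$ with $\bigwedge_{k=1}^n y_k\neq 0_M$, the condition $x\wedge y_k\neq 0_M$ for every $k$ implies $x\wedge\bigl(\bigwedge_{k=1}^n y_k\bigr)\neq 0_M$. ''$\kappa_a$ preserves essential elements (resp. $\mu$-elements)'' means that $\kappa_a$ sends every essential element (resp. $\mu$-element) of $L$ to an essential element (resp. $\mu$-element) of $a^{\uparrow}$. The annihilator of $a$ is $a^{\perp}:=\bigvee\{x\in L\mid x\wedge a=0\}$, $a^{\perp\perp}:=(a^{\perp})^{\perp}$, and $a$ is regular if $a^{\perp\perp}=a$. *)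

(* Defs.v *)
From HB Require Import structures.
From mathcomp Require Import all_boot all_order.
From mathcomp Require Import boolp classical_sets.

Set Implicit Arguments.
Unset Strict Implicit.
Unset Printing Implicit Defensive.

Import Order.TTheory.
Local Open Scope classical_set_scope.
Local Open Scope order_scope.

(* Bounds and binary distributivity are inherited from the library's           *)
(* tbDistrLatticeType; both follow from the two axioms below (see the factory  *)
(* TBLattice_isFrame for distributivity), so they add no restriction.          *)
HB.mixin Record isFrame d T of Order.TBLattice d T := {
  bigsup : set T -> T;
  bigsup_isLub : forall A : set T, isLub A (bigsup A);
  meet_bigsup : forall (x : T) (A : set T),
    x `&` bigsup A = bigsup [set x `&` y | y in A]
}.

#[short(type="frameType")]
HB.structure Definition Frame d :=
  { T of Order.TBDistrLattice d T & isFrame d T }.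

HB.factory Record TBLattice_isFrame d T of Order.TBLattice d T := {
  bigsup : set T -> T;
  bigsup_isLub : forall A : set T, isLub A (bigsup A);
  meet_bigsup : forall (x : T) (A : set T),
    x `&` bigsup A = bigsup [set x `&` y | y in A]
}.

HB.builders Context d T of TBLattice_isFrame d T.

Let bigsup2 (y z : T) : bigsup [set y; z] = y `|` z.
Proof.
have [ub least] := bigsup_isLub [set y; z].
apply: le_anti; apply/andP; split.
- by apply: least => _ [->|->]; rewrite ?leUl ?leUr.
- by rewrite leUx !ub //; [right | left].
Qed.

Let meetUl : @left_distributive T T Order.meet Order.join.
Proof.
move=> x y z; rewrite meetC -bigsup2 meet_bigsup image_setU !image_set1 bigsup2.
by rewrite ![z `&` _]meetC.
Qed.

HB.instance Definition _ := Order.Lattice_Meet_isDistrLattice.Build d T meetUl.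
HB.instance Definition _ := isFrame.Build d T bigsup_isLub meet_bigsup.

HB.end.

(* The principal up-set of a, as a type. *)
Record upset d (L : frameType d) (a : L) := Upset {
  upset_val : L;
  upset_valP : a <= upset_val
}.

Section UpsetFrame.
Context d (L : frameType d) (a : L).
Implicit Types u v : upset a.

HB.instance Definition _ := [isSub for @upset_val d L a].
HB.instance Definition _ := [Choice of upset a by <:].

Let upset_meet_closed : {in (fun x : L => a <= x) &, forall x y, a <= x `&` y}.
Proof. by move=> x y; rewrite !unfold_in lexI => -> ->. Qed.

Let upset_join_closed : {in (fun x : L => a <= x) &, forall x y, a <= x `|` y}.
Proof. by move=> x y; rewrite !unfold_in => ax _; apply: lexU2; rewrite ax. Qed.

HB.instance Definition _ := Order.SubChoice_isSubLattice.Build d L _ d (upset a)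
  upset_meet_closed upset_join_closed.

Let upset_bot_le u : Upset (lexx a) <= u.
Proof. by rewrite -Order.le_val /=; exact: upset_valP. Qed.

Let upset_le_top u : u <= Upset (lex1 a).
Proof. by rewrite -Order.le_val /= lex1. Qed.

HB.instance Definition _ := Order.hasBottom.Build d (upset a) upset_bot_le.
HB.instance Definition _ := Order.hasTop.Build d (upset a) upset_le_top.

(* The join with a only matters for the empty family. *)
Definition upset_bigsup (A : set (upset a)) : upset a :=
  Upset (leUr a (bigsup (\val @` A))).

Let upset_bigsup_isLub A : isLub A (upset_bigsup A).
Proof.
have [ub least] := bigsup_isLub (\val @` A); split=> [u Au | v vub].
- by rewrite -Order.le_val /= lexU2 // ub //; exists u.
- rewrite -Order.le_val /= leUx (upset_valP v) andbT.
  by apply: least => _ [u Au <-]; rewrite Order.le_val vub.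
Qed.

Let upset_meet_bigsup u (A : set (upset a)) :
  u `&` upset_bigsup A = upset_bigsup [set u `&` v | v in A].
Proof.
apply: val_inj => /=.
rewrite meetUr meet_bigsup (meet_idPr (upset_valP u)); congr (bigsup _ `|` a).
rewrite eqEsubset; split=> x.
- by move=> [_ [v Av <-] <-]; exists (u `&` v) => //; exists v.
- by move=> [_ [v Av <-] <-]; exists (\val v) => //; exists v.
Qed.

HB.instance Definition _ :=
  TBLattice_isFrame.Build d (upset a) upset_bigsup_isLub upset_meet_bigsup.

Definition kappa (x : L) : upset a := Upset (leUr a x).

End UpsetFrame.

Definition essential d (M : bLatticeType d) (x : M) : Prop :=
  forall y : M, y != \bot -> x `&` y != \bot.

Definition mu_element d (M : tbLatticeType d) (x : M) : Prop :=
  forall (n : nat) (y : 'I_n -> M), (2 <= n)%N ->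
    \meet_(k < n) y k != \bot ->
    (forall k, x `&` y k != \bot) ->
    x `&` \meet_(k < n) y k != \bot.

Definition annihilator d (L : frameType d) (a : L) : L :=
  bigsup [set x : L | x `&` a = \bot].

Definition regular d (L : frameType d) (a : L) : Prop :=
  annihilator (annihilator a) = a.

(* Main.v *)
Require Import Defs.
From HB Require Import structures.
From mathcomp Require Import all_boot all_order.
From mathcomp Require classical_sets.

(** The annihilator of [b] is the pseudocomplement of [b], so [a] is regular
    exactly when [u <= a] is equivalent to [u `&` annihilator a = \bot].  For a
    regular [a], being nonzero in the up-set of [a] is therefore tested
    in [L] after meeting with [annihilator a], which transports both properties
    along [kappa a].  Conversely [a `|` annihilator a] is always essential in
    [L]; its meet with the double annihilator of [a] is [a], so if its image is
    essential then the double annihilator is [a]. *)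

Import Order.TTheory.
Local Open Scope order_scope.

Lemma annihilator_meet {d} {L : frameType d} (b : L) :
  annihilator b `&` b = \bot.
Proof.
rewrite meetC /annihilator meet_bigsup; apply/eqP; rewrite -lex0.
have [_ least] := bigsup_isLub (classical_sets.image
  (fun x : L => x `&` b = \bot) (fun x => b `&` x)).
by apply: least => _ [x xb <-]; rewrite meetC xb.
Qed.

Lemma le_annihilator {d} {L : frameType d} (b u : L) :
  (u <= annihilator b) = (u `&` b == \bot).
Proof.
apply/idP/eqP => [ub | ub].
- by apply/eqP; rewrite -lex0 -(annihilator_meet b) leI2.
- by have [+ _] := bigsup_isLub (fun x : L => x `&` b = \bot); apply.
Qed.

Lemma le_regular {d} {L : frameType d} {a : L} (u : L) :
  regular a -> (u <= a) = (u `&` annihilator a == \bot).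
Proof. by move=> reg; rewrite -le_annihilator reg. Qed.

Lemma le_double_annihilator {d} {L : frameType d} (a : L) :
  a <= annihilator (annihilator a).
Proof. by rewrite le_annihilator meetC annihilator_meet. Qed.

(** If [y] misses both joinands, missing [a] puts [y] below [annihilator a], so [y] is its own meet
    with [annihilator a], which is [\bot]. *)
Lemma essential_join_annihilator {d} {L : frameType d} (a : L) :
  essential (a `|` annihilator a).
Proof.
move=> y; apply: contraNN; rewrite -!lex0 meetUl leUx => /andP[ay y'].
apply: le_trans y'; rewrite lexI lexx andbT le_annihilator.
by rewrite -lex0 meetC.
Qed.

Lemma upset_eq_bot {d} {L : frameType d} {a : L} (u : upset a) :
  (u == \bot) = (\val u <= a).
Proof. by rewrite -lex0 -Order.le_val. Qed.

(** By distributivity, the joinand [a] contributes only a part below [a]. *)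
Lemma kappa_meet_eq_bot {d} {L : frameType d} (a x : L) (u : upset a) :
  (kappa a x `&` u == \bot) = (x `&` \val u <= a).
Proof. by rewrite upset_eq_bot /= meetUl leUx leIl andbT. Qed.

Lemma val_upset_meets {d} {L : frameType d} {a : L} n (y : 'I_n -> upset a) :
  \val (\meet_(k < n) y k) = \meet_(k < n) \val (y k).
Proof. exact: (big_morph (\val : upset a -> L)). Qed.

Lemma regular_of_kappa_essential {d} {L : frameType d} (a : L) :
  (forall x : L, essential x -> essential (kappa a x)) -> regular a.
Proof.
move=> /(_ _ (essential_join_annihilator a)) ess.
apply: le_anti; rewrite le_double_annihilator andbT.
pose u : upset a := Upset (le_double_annihilator a).
suff: u == \bot by rewrite upset_eq_bot.
apply/negPn/negP => /ess; rewrite kappa_meet_eq_bot /= meetUl.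
by rewrite [annihilator a `&` _]meetC annihilator_meet joinx0 leIl.
Qed.

Lemma kappa_essential {d} {L : frameType d} (a x : L) :
  regular a -> essential x -> essential (kappa a x).
Proof.
move=> reg ess u; rewrite kappa_meet_eq_bot upset_eq_bot !(le_regular _ reg).
(* Essentiality of [x] is tested on [\val u]&[annihilator a]. *)
by rewrite -meetA; apply: ess.
Qed.

Lemma kappa_mu_element {d} {L : frameType d} (a x : L) :
  regular a -> mu_element x -> mu_element (kappa a x).
Proof.
move=> reg mu n y n2; rewrite kappa_meet_eq_bot upset_eq_bot val_upset_meets.
rewrite !(le_regular _ reg) => y0 xy.
(* Each factor is cut down by [annihilator a], so that [mu] applies to the [z k] in [L]. *)
pose z k := \val (y k) `&` annihilator a.
have zE : \meet_(k < n) z k = (\meet_(k < n) \val (y k)) `&` annihilator a.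
  rewrite big_split /=; congr (_ `&` _); apply: le_anti.
  apply/andP; split; last by apply/meetsP.
  (* An index exists since [2 <= n]; an empty meet would be [\top]. *)
  exact: (meets_inf (j := Ordinal (ltnW n2)) (fun=> annihilator a)).
rewrite -meetA -zE; apply: mu => // [|k]; first by rewrite zE.
by move: (xy k); rewrite kappa_meet_eq_bot (le_regular _ reg) -meetA.
Qed.

Theorem proposition3p14 (d : Order.disp_t) (L : frameType d) (a : L) :
  [<-> (* (1) *) forall x : L, essential x -> essential (kappa a x);
       (* (2) *) regular a;
       (* (3) *) (forall x : L, essential x -> essential (kappa a x)) /\
                 (forall x : L, mu_element x -> mu_element (kappa a x))].
Proof.
tfae.
- exact: regular_of_kappa_essential.
- by move=> reg; split=> x; [apply: kappa_essential | apply: kappa_mu_element].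
- by case.
Qed.
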